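(* Let $(a_{ij})_{(i,j)\in\mathbb{N}^2}$ be a family of elements of $\mathbb{K}$ such that the double series $\sum_{i,j} a_{ij}$ converges. Then for every $i\in\mathbb{N}$ the series $\sum_{j} a_{ij}$ converges, the series $\sum_{i}\bigl(\sum_{j} a_{ij}\bigr)$ converges, and $$\sum_{i}\Bigl(\sum_{j} a_{ij}\Bigr)=\sum_{i,j} a_{ij}.$$
   Context: $\mathbb{K}$ is a non-Archimedean ordered field (i.e. it contains an element larger than every integer), equipped with its order topology, which is (Cauchy) complete and has a countable basis of neighbourhoods of $0$. $|x|=\max(x,-x)\in\mathbb{K}$. $\mathbb{N}=\{0,1,2,\dots\}$. A series $\sum_n c_n=\sum_{n=0}^\infty c_n$ in $\mathbb{K}$ converges to $c$ if its sequence of partial sums converges to $c$. A double series $\sum_{i,j}a_{ij}$ over $(i,j)\in\mathbb{N}^2$ is said to converge if, for a bijection $k\mapsto(\phi(k),\psi(k))$ from $\mathbb{N}$ to $\mathbb{N}^2$, the ordinary series $\sum_k a_{\phi(k),\psi(k)}$ converges; its sum is then by definition the sum of this ordinary series (convergence and sum do not depend on the chosen bijection). *)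

(* Defs.v *)
From HB Require Import structures.
From mathcomp Require Import all_boot all_order all_algebra.
From mathcomp Require Import all_classical all_reals all_analysis.

Set Implicit Arguments.
Unset Strict Implicit.
Unset Printing Implicit Defensive.

Import Order.TTheory GRing.Theory Num.Theory.
(* With these instances every realFieldType carries its order topology
   (see real_order_nbhsE), and its uniformity is generated by the sets
   {(x, y) | `|x - y| < e} for e > 0 in the field itself. *)
Import numFieldNormedType.Exports.

Local Open Scope classical_set_scope.
Local Open Scope ring_scope.

Definition non_archimedean (K : realFieldType) : Prop :=
  exists x : K, forall m : int, m%:~R < x.

(* Sequential completeness; when 0 has a countable basis of neighbourhoods it
   is equivalent to the convergence of all Cauchy filters. *)
Definition cauchy_complete (K : realFieldType) : Prop :=
  forall u : nat -> K, cauchy (u @ \oo) -> cvgn u.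

Definition countable_nbhs_basis (T : topologicalType) (x : T) : Prop :=
  exists B : set_system T,
    [/\ countable B,
        B `<=` nbhs x &
        forall U, nbhs x U -> exists2 V, B V & V `<=` U].

Definition double_series_cvg_to (K : realFieldType)
    (a : nat -> nat -> K) (s : K) : Prop :=
  exists2 phi : nat -> nat * nat,
    bijective phi & series (fun k => a (phi k).1 (phi k).2) @ \oo --> s.

(* Main.v *)
(* If x exceeds every integer, then a finite sum of terms of size at most e / x,
   no matter how many, has size at most e.  Hence a series converges as soon as
   its terms tend to 0, which gives the rows.  Moreover, all but finitely many
   of the a i j, say those outside a finite set r, are at most e / x, so the sum
   over any rectangle containing r is within e of the sum over r; letting the
   width of the rectangle tend to infinity, the same holds for the partial sums
   of the row sums. *)

Require Import Defs.
From HB Require Import structures.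
From mathcomp Require Import all_boot all_order all_algebra.
From mathcomp Require Import all_classical all_reals all_analysis.

Set Implicit Arguments.
Unset Strict Implicit.
Unset Printing Implicit Defensive.

Import Order.TTheory GRing.Theory Num.Theory.
Import numFieldNormedType.Exports.

Local Open Scope classical_set_scope.
Local Open Scope ring_scope.

Lemma nonarch_sum_small (K : realFieldType) (e : K) :
  non_archimedean K -> 0 < e ->
  exists2 d : K, 0 < d &
    forall (I : Type) (r : seq I) (P : pred I) (F : I -> K),
      (forall i, P i -> `|F i| <= d) -> `|\sum_(i <- r | P i) F i| <= e.
Proof.
move=> [x xP] e0; have x0 : 0 < x by exact: (xP 0).
exists (e / x) => [|I r P F Fd]; first exact: divr_gt0.
apply: (le_trans (ler_norm_sum _ _ _)).
apply: (@le_trans _ _ (\sum_(i <- r | P i) e / x)); first exact: ler_sum.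
rewrite big_const_seq iter_addr_0 -mulr_natr mulrAC ler_pdivrMr//.
by rewrite ler_pM2l// ltW// (xP (count P r)).
Qed.

Lemma nonarch_cvg_series (K : realFieldType) (u : nat -> K) :
  non_archimedean K -> cauchy_complete K ->
  u @ \oo --> (0 : K) -> cvgn (series u).
Proof.
move=> Kna Kc u0; apply: Kc; apply/cauchy_seriesP => e e0.
(* The finite-sum bound is non-strict while the Cauchy criterion asks for [< e], hence [e / 2]. *)
have e20 : 0 < e / 2 by rewrite divr_gt0.
have [d d0 dP] := nonarch_sum_small Kna e20.
have /cvgr0Pnorm_le/(_ _ d0) [N _ NP] := u0.
exists ([set n | (N <= n)%N], [set n | (N <= n)%N]).
  by split; exists N.
move=> [m n] [/= Nm _].
apply: (@le_lt_trans _ _ (e / 2)); last by rewrite gtr_pMr// invf_lt1// ltr1n.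
rewrite big_seq_cond; apply: dP => k; rewrite andbT mem_index_iota.
by move=> /andP[mk _]; apply: NP => /=; exact: leq_trans mk.
Qed.

(** A value [k] can be taken only at the argument [g k], so beyond all [g k] with [k < N] the values
    of [f] are at least [N]. *)
Lemma can_cvg_infty (f g : nat -> nat) : cancel f g -> f @ \oo --> \oo.
Proof.
move=> fK A [N _ NA]; exists (\max_(k < N) g k).+1 => // n /= Mn.
apply: NA => /=; rewrite leqNgt; apply/negP => fnN.
by move: Mn; rewrite ltnNge (bigop.bigmax_sup (Ordinal fnN)) //= fK.
Qed.

(** The members of the rectangle that lie in [r] form a permutation of [r], as both lists are
    duplicate-free. *)
Lemma big_rectangle_split (K : zmodType) (a : nat -> nat -> K)
    (r : seq (nat * nat)) (n m : nat) :
  uniq r -> (forall p, p \in r -> (p.1 < n)%N && (p.2 < m)%N) ->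
  \sum_(0 <= i < n) \sum_(0 <= j < m) a i j =
  \sum_(p <- r) a p.1 p.2 +
  \sum_(p <- [seq (i, j) | i <- index_iota 0 n, j <- index_iota 0 m]
         | p \notin r) a p.1 p.2.
Proof.
move=> ur rP; set R := [seq _ | _ <- _, _ <- _].
have -> : \sum_(0 <= i < n) \sum_(0 <= j < m) a i j =
          \sum_(p <- R) a p.1 p.2 by rewrite big_allpairs_dep.
rewrite (bigID (mem r))/=; congr (_ + _).
rewrite -big_filter; apply: perm_big; apply: uniq_perm => //.
  by rewrite filter_uniq// allpairs_uniq ?iota_uniq// => -[? ?] [? ?].
move=> p; rewrite mem_filter /=; case pr: (p \in r) => //=.
have /andP[p1 p2] := rP _ pr.
apply/allpairsP; exists p; rewrite !mem_index_iota p1 p2; split=> //.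
by case: (p).
Qed.

Theorem theorem4p3 (K : realFieldType)
    (K_nonarch : non_archimedean K)
    (K_complete : cauchy_complete K)
    (K_count : countable_nbhs_basis (0 : K))
    (a : nat -> nat -> K) (s : K)
    (a_cvg : double_series_cvg_to a s) :
  [/\ forall i : nat, cvgn (series (a i)),
      cvgn (series (fun i : nat => limn (series (a i)))) &
      limn (series (fun i : nat => limn (series (a i)))) = s].
Proof.
have [phi [psi phiK psiK] phis] := a_cvg.
set b := fun k => a (phi k).1 (phi k).2.
have b0 : b @ \oo --> (0 : K).
  by apply: cvg_series_cvg_0; apply/cvg_ex; exists s.
have rows i : cvgn (series (a i)).
  apply: nonarch_cvg_series => //.
  (* Row [i] samples the null sequence [b] at the positions [psi (i, j)], which tend to infinity
     because [j] can be recovered from them. *)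
  have -> : a i = b \o (fun j => psi (i, j)).
    by apply/funext => j; rewrite /b /= psiK.
  apply: cvg_comp b0; apply: (@can_cvg_infty _ (fun k => (phi k).2)) => j.
  by rewrite psiK.
suff rs : series (fun i => limn (series (a i))) @ \oo --> s.
  by split => //; [apply/cvg_ex; exists s | exact: cvg_lim].
apply/cvgrPdist_le => e e0.
have e20 : 0 < e / 2 by rewrite divr_gt0.
have [d d0 dP] := nonarch_sum_small K_nonarch e20.
have /cvgr0Pnorm_le/(_ _ d0) [N1 _ N1P] := b0.
have /cvgrPdist_le/(_ _ e20) [N2 _ N2P] := phis.
(* The sum over [r] is the [N]-th partial sum of [b], within [e / 2] of [s]; every term enumerated
   from [N] on is at most [d]. *)
pose N := maxn N1 N2; pose r := [seq phi k | k <- index_iota 0 N].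
pose M := (\max_(p <- r) maxn p.1 p.2).+1.
have rM p : p \in r -> (p.1 < M)%N && (p.2 < M)%N.
  by move=> pr; rewrite !ltnS -geq_max; exact: leq_bigmax_seq.
have ur : uniq r by rewrite map_inj_uniq ?iota_uniq//; exact: can_inj phiK.
exists M => // n /= Mn.
pose S m := \sum_(0 <= i < n) series (a i) m.
have cS : S @ \oo --> series (fun i => limn (series (a i))) n.
  apply: cvg_big => [|i _]; last exact: rows.
  exact: add_continuous.
have far p : p \notin r -> `|a p.1 p.2| <= d.
  move=> pr; rewrite -[p]psiK; apply: N1P => /=.
  have : psi p \notin index_iota 0 N.
    by apply: contra pr => /(map_f phi); rewrite psiK.
  by rewrite mem_index_iota /= -leqNgt; apply: leq_trans; exact: leq_maxl.
(* With [n] fixed, a non-strict bound on [|s - S m|] for all large [m] survives the limit. *)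
apply: cvgr_to_le (cvg_norm (cvgB (cvg_cst s) cS)) _.
exists M => // m /= Mm.
rewrite -[X in X <= _]/`|s - S m| /S /series /= (big_rectangle_split _ ur) //; last first.
  by move=> p /rM/andP[p1 p2]; rewrite (leq_trans p1)// (leq_trans p2).
(* The distance from [s] to the sum over [r] and the sum outside [r] each cost [e / 2], the latter
   whatever [n] and [m] are. *)
rewrite big_map opprD addrA (splitr e).
apply: (le_trans (ler_normB _ _)); apply: lerD; last exact: dP.
by apply: (N2P N); exact: leq_maxr.
Qed.
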